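(* Let $M \in \mathbb{R}^{m \times n}_+$. If $M^T M$ is irreducible, then for any rank $r$ the semi-NMF problem $$\min_{U \in \mathbb{R}^{m\times r},\, V \in \mathbb{R}^{r \times n}} \|M-UV\|_F^2 \quad \text{such that } V \geq 0$$ can be solved via the truncated singular value decomposition (SVD); that is, the rank-$r$ truncated SVD $X$ of $M$ (a best rank-$r$ approximation of $M$ in Frobenius norm) can be written as $X = UV$ with $U \in \mathbb{R}^{m\times r}$, $V \in \mathbb{R}^{r\times n}$, $V \geq 0$, and such a pair $(U,V)$ is an optimal solution of the semi-NMF problem.
   Context: $\mathbb{R}^{m\times n}_+$ is the set of component-wise nonnegative $m \times n$ matrices; $V \geq 0$ means component-wise nonnegative; $\|\cdot\|_F$ is the Frobenius norm. A square matrix $A$ is irreducible if the directed graph induced by $A$ (with an edge between $i$ and $j$ when $A_{ij} \neq 0$) is strongly connected, i.e., every vertex is reachable from every other vertex. The rank-$r$ truncated SVD of $M$ is the matrix obtained by keeping the $r$ leading terms of an SVD of $M$. *)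

(* Defs.v *)
From HB Require Import structures.
From mathcomp Require Import all_boot all_order all_algebra.
From mathcomp Require Import reals.

Set Implicit Arguments.
Unset Strict Implicit.
Unset Printing Implicit Defensive.

Import Order.TTheory GRing.Theory Num.Theory.
Local Open Scope ring_scope.

Definition nonneg_mx (R : realType) (m n : nat) (A : 'M[R]_(m, n)) : bool :=
  A \is a mxOver Num.nneg.

Definition frobenius (R : realType) (m n : nat) (A : 'M[R]_(m, n)) : R :=
  Num.sqrt (\sum_i \sum_j A i j ^+ 2).

(* [connect] is reflexive, so the diagonal case [i = j] imposes nothing; in
   particular every matrix of size at most 1 is irreducible. *)
Definition irreducible_mx (R : realType) (n : nat) (A : 'M[R]_n) : Prop :=
  forall i j : 'I_n, connect [rel x y : 'I_n | A x y != 0] i j.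

(* Full SVD: [S] is rectangular diagonal, and the last field says that its
   diagonal entries are nonincreasing. *)
Record is_svd (R : realType) (m n : nat) (M : 'M[R]_(m, n))
    (P : 'M[R]_m) (S : 'M[R]_(m, n)) (Q : 'M[R]_n) : Prop := IsSvd {
  svd_eq : M = P *m S *m Q^T;
  svd_left_orthogonal : P^T *m P = 1%:M;
  svd_right_orthogonal : Q^T *m Q = 1%:M;
  svd_diag : is_diag_mx S;
  svd_nonneg : nonneg_mx S;
  svd_sorted : forall (i1 i2 : 'I_m) (j1 j2 : 'I_n),
    i1 = j1 :> nat -> i2 = j2 :> nat -> (i1 <= i2)%N -> S i2 j2 <= S i1 j1
}.

(* [pid_mx r *m S] zeroes the rows of [S] of index at least [r], hence keeps
   the [r] largest singular values; when [r >= minn m n] it is [S].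
   This is a relation because repeated singular values can make the truncation
   depend on the chosen SVD. *)
Definition is_truncated_svd (R : realType) (m n r : nat)
    (M X : 'M[R]_(m, n)) : Prop :=
  exists (P : 'M[R]_m) (S : 'M[R]_(m, n)) (Q : 'M[R]_n),
    is_svd M P S Q /\ X = P *m (pid_mx r *m S) *m Q^T.

Definition is_best_rank_approx (R : realType) (m n r : nat)
    (M X : 'M[R]_(m, n)) : Prop :=
  (\rank X <= r)%N /\
  forall Y : 'M[R]_(m, n),
    (\rank Y <= r)%N -> frobenius (M - X) <= frobenius (M - Y).

Definition is_semi_nmf_solution (R : realType) (m n r : nat)
    (M : 'M[R]_(m, n)) (U : 'M[R]_(m, r)) (V : 'M[R]_(r, n)) : Prop :=
  nonneg_mx V /\
  forall (U' : 'M[R]_(m, r)) (V' : 'M[R]_(r, n)), nonneg_mx V' ->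
    frobenius (M - U *m V) ^+ 2 <= frobenius (M - U' *m V') ^+ 2.

(* Main.v *)
Require Import Defs.
From HB Require Import structures.
From mathcomp Require Import all_boot all_order all_algebra.
From mathcomp Require Import reals.
From mathcomp Require Import complex ring lra.

Set Implicit Arguments.
Unset Strict Implicit.
Unset Printing Implicit Defensive.

Import Order.TTheory GRing.Theory Num.Theory.
Local Open Scope ring_scope.

(* Let q be the first right singular vector of an SVD of M. It maximizes the
   Rayleigh quotient of the nonnegative matrix M^T M, and so does its entrywise
   absolute value |q|, which is therefore a top eigenvector too. Irreducibility
   then forces all the entries of q to be nonzero and of the same sign
   (Perron-Frobenius). Since q spans a row of the rank-r factor W of the
   truncated SVD X = U0 W, adding a large multiple of that row to every row of
   W is an invertible operation that makes W nonnegative. Optimality is the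
   Eckart-Young theorem, as every product U V has rank at most r.

   Eckart-Young: if T is the orthogonal projector on the row space of Y, then
   |S - Y|^2 >= |S|^2 - |S T|^2, and |S T|^2 is a combination of the squared
   singular values with weights T j j in [0, 1] of total weight rank Y. *)

(** * Squared Frobenius norm and its orthogonal invariance *)

(** The trace form makes orthogonal invariance a matrix computation, and without a square root it
    makes sense over any ring. *)
Definition sqn (R : pzRingType) (m n : nat) (A : 'M[R]_(m, n)) : R :=
  \tr (A^T *m A).

Lemma sqnE (R : pzRingType) (m n : nat) (A : 'M[R]_(m, n)) :
  sqn A = \sum_j \sum_i A i j ^+ 2.
Proof.
by apply: eq_bigr => j _; rewrite mxE; apply: eq_bigr => i _; rewrite mxE.
Qed.

Lemma sqnZ (R : comPzRingType) (m n : nat) a (A : 'M[R]_(m, n)) :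
  sqn (a *: A) = a ^+ 2 * sqn A.
Proof.
by rewrite /sqn [in X in X *m _]linearZ /= -scalemxAl -scalemxAr !mxtraceZ mulrA.
Qed.

Lemma sqn_ge0 (R : realDomainType) (m n : nat) (A : 'M[R]_(m, n)) : 0 <= sqn A.
Proof. by rewrite sqnE; do 2!apply: sumr_ge0 => ? _; exact: sqr_ge0. Qed.

Lemma sqn_eq0 (R : realDomainType) (m n : nat) (A : 'M[R]_(m, n)) :
  sqn A = 0 -> A = 0.
Proof.
rewrite sqnE => /psumr_eq0P s0; apply/matrixP => i j; rewrite mxE.
have s0j : forall j, \sum_i A i j ^+ 2 = 0.
  by move=> k; apply: s0 => // l _; apply: sumr_ge0 => ? _; exact: sqr_ge0.
have /psumr_eq0P/(_ i isT)/eqP := s0j j.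
rewrite sqrf_eq0 => /(_ _)/eqP; apply=> k _; exact: sqr_ge0.
Qed.

Lemma sqn_mulmx (R : comPzRingType) (k m n : nat) (P : 'M[R]_(k, m))
    (A : 'M[R]_(m, n)) : P^T *m P = 1%:M -> sqn (P *m A) = sqn A.
Proof. by move=> PP; rewrite /sqn trmx_mul mulmxA -(mulmxA _ P^T) PP mulmx1. Qed.

Lemma sqn_orthogonal (R : comPzRingType) (m n : nat) (P : 'M[R]_m)
    (A : 'M[R]_(m, n)) (Q : 'M[R]_n) :
  P^T *m P = 1%:M -> Q^T *m Q = 1%:M -> sqn (P *m A *m Q^T) = sqn A.
Proof.
move=> PP QQ; rewrite /sqn !trmx_mul trmxK.
rewrite mxtrace_mulC !mulmxA -mulmxA -(mulmxA _ Q^T) QQ mulmx1.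
rewrite mxtrace_mulC !mulmxA -(mulmxA _ P^T) PP mulmx1 //.
Qed.

Lemma frobeniusE (R : realType) (m n : nat) (A : 'M[R]_(m, n)) :
  frobenius A = Num.sqrt (sqn A).
Proof. by rewrite sqnE exchange_big. Qed.

Lemma ler_frobenius (R : realType) (m n : nat) (A B : 'M[R]_(m, n)) :
  sqn A <= sqn B -> frobenius A <= frobenius B.
Proof. by rewrite !frobeniusE => /ler_wsqrtr. Qed.

(** * Existence of a singular value decomposition *)

Local Notation "M ^t*" := (map_mx Num.conj M^T) (at level 30).

(** The spectral theorem diagonalizes [A] over the complex extension of [R]. The largest eigenvalue
    is real, hence already an eigenvalue over [R], which yields a real eigenvector. *)
Lemma top_eigenpair (R : rcfType) (n : nat) (A : 'M[R]_n.+1) : A^T = A ->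
  exists (lam : R) (v : 'cV_n.+1), [/\ v != 0, A *m v = lam *: v &
    forall x : 'cV_n.+1, \tr (x^T *m A *m x) <= lam * sqn x].
Proof.
move=> symA; pose f := real_complex R; pose B := map_mx f A.
have realf m k (X : 'M[R]_(m, k)) : map_mx f X \is a mxOver Num.real.
  by apply/mxOverP => i j; rewrite mxE complex_real.
have hermB : B \is hermsymmx.
  apply: realsym_hermsym (realf _ _ A).
  by apply/is_hermitianmxP; rewrite expr0 scale1r map_mx_id // map_trmx symA.
have /orthomx_spectralP := hermitian_normalmx hermB.
have /mxOverP := hermitian_spectral_diag_real hermB.
have := spectral_unitarymx B.
move: (spectralmx B) (spectral_diag B) => P d Pu dreal eqB.
have Punit := unitarymx_unit Pu.
pose j := [arg max_(i > ord0 : 'I_n.+1) complex.Re (d 0 i)]%O.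
have maxj i : complex.Re (d 0 i) <= complex.Re (d 0 j).
  by rewrite /j; case: Order.TotalTheory.arg_maxP => // k _; apply.
pose lam := complex.Re (d 0 j).
have dE i : d 0 i = f (complex.Re (d 0 i)) by exact/esym/RRe_real/dreal.
have : eigenvalue A lam.
  rewrite -(eigenvalue_map f); apply/eigenvalueP; exists (row j P).
    rewrite -/B eqB -row_mul !mulmxA mulmxV // mul1mx row_mul.
    by rewrite row_diag_mx -scalemxAl -rowE dE.
  apply: contraTneq Punit => Pj0; rewrite -row_free_unit.
  apply/negP => /row_free_inj inj.
  have := inj _ (delta_mx 0 j : 'rV_n.+1) 0.
  rewrite -rowE Pj0 mul0mx => /(_ erefl)/matrixP/(_ 0 j)/eqP.
  by rewrite !mxE !eqxx oner_eq0.
case/eigenvalueP => v vA v0; exists lam, v^T; split.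
- by rewrite trmx_eq0.
- by rewrite -{1}symA -trmx_mul vA linearZ.
move=> x; pose y := map_mx f x; pose z := P *m y.
have yT : y^T = y ^t*.
  apply/matrixP => i k; rewrite !mxE; apply/esym/CrealP.
  by rewrite complex_real.
(* Stated for any [E] diagonalized by [P], so that [A] and [lam%:M] can be compared term by term. *)
have trE (e : 'rV_n.+1) (E : 'M_n.+1) :
    map_mx f E = invmx P *m diag_mx e *m P ->
    f (\tr (x^T *m E *m x)) = \sum_i e 0 i * `|z i 0| ^+ 2.
  move=> eqE; rewrite -[f _]trace_map_mx !map_mxM -map_trmx eqE.
  rewrite invmx_unitary // yT !mulmxA.
  have -> : y ^t* *m P ^t* = z ^t* by rewrite trmx_mul map_mxM.
  rewrite -[_ *m P *m y]mulmxA trace_mx11 mxE.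
  apply: eq_bigr => i _; rewrite mul_mx_diag !mxE.
  by rewrite mulrAC mulrC normCKC.
have -> : lam * sqn x = \tr (x^T *m lam%:M *m x).
  by rewrite mul_mx_scalar -scalemxAl mxtraceZ.
rewrite -lecR -/(f _) -/(f (\tr (x^T *m lam%:M *m x))) (trE _ _ eqB).
rewrite (trE (const_mx (f lam))); last first.
  by rewrite map_scalar_mx diag_const_mx mul_mx_scalar -scalemxAl mulVmx //
    scalemx1.
apply: ler_sum => i _; rewrite ler_wpM2r ?exprn_ge0 //.
by rewrite (dE i) mxE lecR.
Qed.

(* [H] is the reflection exchanging [v] and the first basis vector. *)
Lemma householder (R : rcfType) (n : nat) (v : 'cV[R]_n.+1) : sqn v = 1 ->
  exists H : 'M[R]_n.+1, [/\ H^T = H, H *m H = 1%:M & H *m delta_mx 0 0 = v].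
Proof.
move=> v1; pose e : 'cV[R]_n.+1 := delta_mx 0 0; pose w := v - e.
have dotE (x y : 'cV[R]_n.+1) : x^T *m y = (\tr (x^T *m y))%:M.
  by rewrite [LHS]mx11_scalar -trace_mx11.
have e1 : sqn e = 1.
  by rewrite /sqn trmx_delta mul_delta_mx trace_mx11 mxE.
have ve : \tr (v^T *m e) = \tr (e^T *m v) by rewrite -mxtrace_tr trmx_mul trmxK.
have ww : sqn w = 2 - 2 * \tr (e^T *m v).
  rewrite /sqn /w [(v - e)^T]linearB /= mulmxBl !mulmxBr !linearB /=.
  rewrite -/(sqn v) -/(sqn e).
  by rewrite v1 e1 ve; ring.
(* If [v] is already the basis vector, no reflection is defined by [w] and the identity serves. *)
have [w0|wN0] := eqVneq w 0.
  exists 1%:M; split; rewrite ?trmx1 ?mulmx1 ?mul1mx //.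
  by move/subr0_eq: w0 => ->.
have swN0 : sqn w != 0 by apply: contra_neq wN0; exact: sqn_eq0.
pose H : 'M_n.+1 := 1%:M - (2 / sqn w) *: (w *m w^T); exists H; split.
- by rewrite /H linearB /= trmx1 linearZ /= trmx_mul trmxK.
- have ww2 : w *m w^T *m (w *m w^T) = sqn w *: (w *m w^T).
    rewrite -mulmxA (mulmxA w^T) (dotE w w) mul_scalar_mx -scalemxAr //.
  rewrite /H mulmxBl mul1mx mulmxBr mulmx1 -scalemxAl -scalemxAr ww2 !scalerA.
  have -> : 2 / sqn w * (2 / sqn w) * sqn w = 2 / sqn w + 2 / sqn w by field.
  by rewrite scalerDl opprB addrK subrK.
- rewrite /H mulmxBl mul1mx -scalemxAl -mulmxA (dotE w e) mul_mx_scalar scalerA.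
  have -> : \tr (w^T *m e) = - (sqn w / 2).
    by rewrite /w [(v - e)^T]linearB /= mulmxBl linearB /= -/(sqn e) e1 ve ww; field.
  have -> : 2 / sqn w * - (sqn w / 2) = -1 by field.
  by rewrite scaleN1r opprK addrC subrK.
Qed.


(* Splits off a top singular pair [(u, v)]: reflections sending [u] and [v] to
   basis vectors make [M] block diagonal with first entry the largest singular
   value. *)
Lemma svd_exists (R : realType) (m n : nat) (M : 'M[R]_(m, n)) :
  exists P S Q, is_svd M P S Q.
Proof.
elim: m n M => [|m IHm] [|n] M; try by
  (exists 1%:M, M, 1%:M; split; rewrite ?trmx1 ?mulmx1 ?mul1mx //;
   [apply/is_diag_mxP => i j; by [case: i | case: j]
   |apply/mxOverP => i j; by [case: i | case: j]
   |by [move=> [] | move=> ? ? []]]).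
(* Away from [M = 0] the top singular value is positive, so [u] can be defined by dividing by it. *)
have [->|M_neq0] := eqVneq M 0.
  exists 1%:M, 0, 1%:M; split; rewrite ?trmx1 ?mulmx1 ?mul1mx ?mx0_is_diag //.
    by apply/mxOverP => i j; rewrite mxE nnegrE.
  by move=> *; rewrite !mxE.
have [|lam [v0 [v0_neq0 MMv0 lam_max]]] := @top_eigenpair R n (M^T *m M).
  by rewrite trmx_mul trmxK.
have {}lam_max (x : 'cV_n.+1) : sqn (M *m x) <= lam * sqn x.
  by apply: le_trans (lam_max x); rewrite /sqn trmx_mul !mulmxA.
have lam_gt0 : 0 < lam.
  rewrite ltNge; apply: contra_neqN M_neq0 => lam_le0.
  suff Mx0 (x : 'cV_n.+1) : M *m x = 0.
    apply/matrixP => i j; have /matrixP/(_ i 0) := Mx0 (delta_mx j 0).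
    by rewrite -colE !mxE.
  apply/sqn_eq0/le_anti; rewrite sqn_ge0 andbT.
  by apply: le_trans (lam_max x) _; rewrite mulr_le0_ge0 ?sqn_ge0.
have sv0_gt0 : 0 < sqn v0.
  by rewrite lt0r sqn_ge0 andbT; apply: contra_neq v0_neq0; exact: sqn_eq0.
pose v := (Num.sqrt (sqn v0))^-1 *: v0.
have v1 : sqn v = 1.
  by rewrite sqnZ exprVn sqr_sqrtr ?ltW // mulVf // gt_eqF.
have MMv : M^T *m (M *m v) = lam *: v.
  by rewrite mulmxA -scalemxAr MMv0 !scalerA mulrC.
pose s := Num.sqrt lam.
have s_gt0 : 0 < s by rewrite sqrtr_gt0.
have ss : s ^+ 2 = lam by rewrite sqr_sqrtr // ltW.
pose u := s^-1 *: (M *m v).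
have Mv : M *m v = s *: u by rewrite scalerA divff ?scale1r // gt_eqF.
have MTu : M^T *m u = s *: v.
  by rewrite -scalemxAr MMv scalerA -ss expr2 mulKf // gt_eqF.
have u1 : sqn u = 1.
  rewrite sqnZ /sqn trmx_mul -mulmxA MMv -scalemxAr mxtraceZ -/(sqn v) v1 -ss.
  by rewrite mulr1 -exprMn mulVf ?expr1n // gt_eqF.
have [Hu [HuT HuHu Hue]] := householder u1.
have [Hv [HvT HvHv Hve]] := householder v1.
pose N := Hu *m M *m Hv.
have Ncol i (j : 'I_n.+1) : j = 0%N :> nat -> N i j = s *+ (i == 0%N :> nat).
  move=> j0; have -> : j = 0 by apply/val_inj.
  have /matrixP/(_ i 0) : N *m delta_mx 0 0 = s *: delta_mx 0 0 :> 'cV_m.+1.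
    by rewrite /N -mulmxA Hve -mulmxA Mv -scalemxAr -Hue mulmxA HuHu mul1mx.
  by rewrite -colE !mxE eqxx andbT mulr_natr.
have Nrow (i : 'I_m.+1) j : i = 0%N :> nat -> N i j = s *+ (j == 0%N :> nat).
  move=> i0; have -> : i = 0 by apply/val_inj.
  have /matrixP/(_ j 0) : N^T *m delta_mx 0 0 = s *: delta_mx 0 0 :> 'cV_n.+1.
    rewrite /N !trmx_mul HvT HuT -!mulmxA Hue MTu -scalemxAr -Hve mulmxA HvHv.
    by rewrite mul1mx.
  by rewrite -colE !mxE eqxx andbT mulr_natr.
have NE : N = block_mx (s%:M : 'M_1) 0 0
    (drsubmx (N : 'M_(1 + m, 1 + n))) :> 'M_(1 + m, 1 + n).
  clearbody N; rewrite -{1}[N](@submxK _ 1 m 1 n); congr block_mx;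
    apply/matrixP => i j.
  - by rewrite !mxE !ord1 Ncol.
  - by rewrite !mxE !ord1 Nrow.
  - by rewrite !mxE !ord1 Ncol.
have [P' [S' [Q' [eqN P'1 Q'1 S'diag S'nneg S'sort]]]] :=
  IHm _ (drsubmx (N : 'M_(1 + m, 1 + n))).
pose BP := block_mx (1%:M : 'M_1) 0 0 P'.
pose BQ := block_mx (1%:M : 'M_1) 0 0 Q'.
pose BS := block_mx (s%:M : 'M_1) 0 0 S'.
have BP1 : BP^T *m BP = 1%:M.
  rewrite tr_block_mx mulmx_block !(trmx1, trmx0, mulmx0, mul0mx, addr0, add0r).
  by rewrite mul1mx P'1 -scalar_mx_block.
have BQ1 : BQ^T *m BQ = 1%:M.
  rewrite tr_block_mx mulmx_block !(trmx1, trmx0, mulmx0, mul0mx, addr0, add0r).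
  by rewrite mul1mx Q'1 -scalar_mx_block.
have NS : N = BP *m BS *m BQ^T :> 'M_(1 + m, 1 + n).
  rewrite NE eqN tr_block_mx !mulmx_block.
  by rewrite !(trmx1, trmx0, mulmx0, mul0mx, addr0, add0r, mul1mx, mulmx1).
(* Abstracting the block matrices lets their dimensions [1 + m] and [1 + n] be read as [m.+1] and
   [n.+1]. *)
have [P [S [Q [P1 Q1 MPSQ SE]]]] : exists (P : 'M_m.+1) (S : 'M_(m.+1, n.+1))
    (Q : 'M_n.+1), [/\ P^T *m P = 1%:M, Q^T *m Q = 1%:M,
    M = P *m S *m Q^T & S = BS].
  move: BP BQ BS BP1 BQ1 NS; rewrite -[(1 + m)%N]/m.+1 -[(1 + n)%N]/n.+1.
  move=> BP BQ BS BP1 BQ1 NS; exists (Hu *m BP), BS, (Hv *m BQ); split=> //.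
  - by rewrite trmx_mul HuT -mulmxA (mulmxA Hu) HuHu mul1mx.
  - by rewrite trmx_mul HvT -mulmxA (mulmxA Hv) HvHv mul1mx.
  - rewrite trmx_mul HvT -!mulmxA (mulmxA BS) (mulmxA BP) (mulmxA BP) -NS.
    by rewrite /N !mulmxA HuHu mul1mx -mulmxA HvHv mulmx1.
have MQ : M *m Q = P *m S by rewrite MPSQ -mulmxA Q1 mulmx1.
(* An entry of [S] is at most the norm of its column, which is the norm of [M] applied to a unit
   vector. Thus [s] also dominates the singular values of the smaller block, as sortedness
   requires. *)
have S_le i j : S i j <= s.
  have := lam_max (Q *m delta_mx j 0).
  rewrite mulmxA MQ -mulmxA (sqn_mulmx _ P1) (sqn_mulmx _ Q1) -colE.
  have -> : sqn (delta_mx j 0 : 'cV[R]_n.+1) = 1.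
    by rewrite /sqn trmx_delta mul_delta_mx trace_mx11 mxE !eqxx.
  rewrite mulr1 -ss => Sjs; rewrite (le_trans (ler_norm _)) //.
  rewrite -[s]gtr0_norm // -ler_sqr ?nnegrE // !real_normK ?num_real //.
  apply: le_trans Sjs; rewrite sqnE big_ord1 (bigD1 i) //= [col _ _ _ _]mxE lerDl.
  by apply: sumr_ge0 => k _; exact: sqr_ge0.
have BS_le i j : BS i j <= s by have := S_le i j; rewrite SE.
exists P, S, Q; split=> //; rewrite SE.
- suff : is_diag_mx BS by [].
  apply/is_diag_mxP => i j.
  case: (split_ordP i) => k ->; case: (split_ordP j) => l -> neq_ij.
  + by move: neq_ij; rewrite !ord1.
  + by rewrite /BS block_mxEur mxE.
  + by rewrite /BS block_mxEdl mxE.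
  + rewrite /BS block_mxEdr; apply: (is_diag_mxP S'diag).
    by apply: contra_neq neq_ij => /= ->.
- suff : nonneg_mx BS by [].
  apply/mxOverP => i j.
  case: (split_ordP i) => k ->; case: (split_ordP j) => l ->.
  + by rewrite /BS block_mxEul !ord1 mxE nnegrE ltW.
  + by rewrite /BS block_mxEur mxE nnegrE.
  + by rewrite /BS block_mxEdl mxE nnegrE.
  + by rewrite /BS block_mxEdr; exact: (mxOverP S'nneg).
- suff : forall (i1 i2 : 'I_(1 + m)) (j1 j2 : 'I_(1 + n)),
      i1 = j1 :> nat -> i2 = j2 :> nat -> (i1 <= i2)%N -> BS i2 j2 <= BS i1 j1 by [].
  move=> i1 i2 j1 j2.
  case: (split_ordP i1) => k1 ->; case: (split_ordP j1) => l1 ->.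
  + by rewrite /BS block_mxEul !ord1 [s%:M _ _]mxE /= => *; exact: BS_le.
  + by rewrite ord1.
  + by rewrite [l1]ord1.
  case: (split_ordP i2) => k2 ->; case: (split_ordP j2) => l2 ->.
  + by rewrite [k2]ord1 [l2]ord1.
  + by rewrite [k2]ord1.
  + by rewrite [l2]ord1.
  + by rewrite /BS !block_mxEdr /= => - [] e1 [] e2 le12; exact: S'sort.
Qed.

(** * The Eckart-Young theorem *)

(** With [B] a basis of the row space, [T] is the usual formula for an orthogonal projector; by
    cyclicity its trace is the number of rows of [B]. *)
Lemma row_projector (R : realFieldType) (m n : nat) (Y : 'M[R]_(m, n)) :
  exists T : 'M[R]_n,
    [/\ T^T = T, T *m T = T, Y *m T = Y & \tr T = (\rank Y)%:R].
Proof.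
have [k [B [Bfree YB <-]]] : exists k (B : 'M_(k, n)),
    [/\ row_free B, (Y <= B)%MS & k = \rank Y].
  by exists (\rank Y), (row_base Y); rewrite row_base_free eq_row_base.
pose G := B *m B^T.
have Gunit : G \in unitmx.
  (* If K G = 0, then |K B|^2 = tr (K G K^T) = 0, and K = 0 because the rows of [B] are
     independent. *)
  rewrite -row_free_unit -kermx_eq0; apply/eqP.
  have KB0 : (kermx G *m B)^T = 0.
    apply: sqn_eq0; rewrite /sqn trmxK trmx_mul mulmxA -(mulmxA _ B) -/G.
    by rewrite mulmx_ker mul0mx mxtrace0.
  by apply/eqP; rewrite -(mulmx_free_eq0 _ Bfree) -trmx_eq0 KB0.
have GT : (invmx G)^T = invmx G by rewrite trmx_inv /G trmx_mul trmxK.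
exists (B^T *m invmx G *m B); split.
- by rewrite !trmx_mul trmxK GT mulmxA.
- by rewrite !mulmxA -(mulmxA _ B) -/G mulmxKV.
- have /submxP[Z ->] := YB.
  by rewrite !mulmxA -(mulmxA _ B) -/G mulmxK.
- by rewrite -mulmxA mxtrace_mulC -mulmxA -/G mulVmx // mxtrace1.
Qed.

Lemma sum_weighted_le_top (R : realFieldType) (n r : nat) (c p : 'I_n -> R) :
  (forall j, 0 <= c j) -> (forall i j : 'I_n, (i <= j)%N -> c j <= c i) ->
  (forall j, 0 <= p j <= 1) -> \sum_j p j <= r%:R ->
  \sum_j p j * c j <= \sum_(j < n | (j < r)%N) c j.
Proof.
move=> c_ge0 c_mono p01 sum_p; rewrite [leRHS]big_mkcond /=.
have [le_nr|lt_rn] := leqP n r.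
  apply: ler_sum => j _; rewrite (leq_trans (ltn_ord j)) // ler_piMl //.
  by case/andP: (p01 j).
(* With [q] the indicator of [j < r], each [(c j - c0) * (p j - q j)] is
   nonpositive. *)
pose c0 := c (Ordinal lt_rn); pose q (j : 'I_n) : R := (j < r)%N%:R.
have sum_q : \sum_j q j = r%:R.
  have -> : \sum_j q j = \sum_(j < n) if (j < r)%N then 1 else 0 :> R.
    by apply: eq_bigr => j _; rewrite /q; case: ifP.
  rewrite -big_mkcond -(big_ord_widen n (fun=> 1)) ?(ltnW lt_rn) //.
  by rewrite sumr_const card_ord.
rewrite -subr_le0 -sumrB.
have /le_trans -> // : \sum_j (p j * c j - (if (j < r)%N then c j else 0)) <=
    \sum_j (p j - q j) * c0.
  apply: ler_sum => j _; rewrite /q; case/andP: (p01 j) => p0 p1.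
  have [lt_jr|le_rj] := ltnP j r.
    have := c_mono j (Ordinal lt_rn) (ltnW lt_jr); rewrite -/c0 mulr1n; nra.
  have := c_mono (Ordinal lt_rn) j le_rj; rewrite -/c0 mulr0n; nra.
by rewrite -mulr_suml sumrB sum_q mulr_le0_ge0 ?c_ge0 // subr_le0.
Qed.

Lemma pid_mulmxE (R : nzSemiRingType) (m n r : nat) (S : 'M[R]_(m, n)) i j :
  (pid_mx r *m S) i j = if (i < r)%N then S i j else 0.
Proof.
rewrite mxE (bigD1 i) //= big1 => [|k neq_ki].
  by rewrite mxE eqxx addr0; case: ifP => _; rewrite ?mul1r ?mul0r.
by rewrite mxE val_eqE eq_sym (negPf neq_ki) mul0r.
Qed.

Lemma mulmx_pidE (R : comNzRingType) (m n r : nat) (S : 'M[R]_(m, n)) i j :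
  (S *m pid_mx r) i j = if (j < r)%N then S i j else 0.
Proof.
by rewrite -[S *m _]trmxK trmx_mul tr_pid_mx mxE pid_mulmxE mxE.
Qed.

Lemma gram_diag (R : pzRingType) (m n : nat) (S : 'M[R]_(m, n)) :
  is_diag_mx S -> S^T *m S = diag_mx (\row_j \sum_i S i j ^+ 2).
Proof.
move=> /is_diag_mxP Sdiag; apply/matrixP => j k; rewrite !mxE.
have [->|neq_jk] := eqVneq j k.
  by apply: eq_bigr => i _; rewrite mxE.
apply: big1 => i _; rewrite mxE.
have [eq_ij|/eqP neq_ij] := (i : nat) =P j.
  by rewrite (Sdiag i k) ?mulr0 // eq_ij.
by rewrite (Sdiag i j) ?mul0r.
Qed.

Lemma sorted_diag_col_sqr (R : realDomainType) (m n : nat) (S : 'M[R]_(m, n)) :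
  is_diag_mx S -> S \is a mxOver Num.nneg ->
  (forall (i1 i2 : 'I_m) (j1 j2 : 'I_n), i1 = j1 :> nat -> i2 = j2 :> nat ->
    (i1 <= i2)%N -> S i2 j2 <= S i1 j1) ->
  forall i j : 'I_n, (i <= j)%N ->
    \sum_k S k j ^+ 2 <= \sum_k S k i ^+ 2.
Proof.
move=> /is_diag_mxP Sdiag /mxOverP Snneg Ssort i j le_ij.
have colE (k : 'I_m) (l : 'I_n) : k = l :> nat ->
    \sum_k S k l ^+ 2 = S k l ^+ 2.
  move=> eq_kl; rewrite (bigD1 k) //= big1 ?addr0 // => k' neq_kk'.
  by rewrite Sdiag ?expr0n // -eq_kl.
have [lt_jm|le_mj] := ltnP j m.
  have lt_im := leq_ltn_trans le_ij lt_jm.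
  rewrite (colE (Ordinal lt_jm)) // (colE (Ordinal lt_im)) //.
  by rewrite ler_sqr; [exact: Ssort | exact: Snneg | exact: Snneg].
rewrite big1 => [|k _]; first by apply: sumr_ge0 => k _; exact: sqr_ge0.
by rewrite Sdiag ?expr0n // neq_ltn (leq_trans (ltn_ord k)).
Qed.

Lemma eckart_young_diag (R : realFieldType) (m n r : nat) (S Y : 'M[R]_(m, n)) :
  is_diag_mx S -> S \is a mxOver Num.nneg ->
  (forall (i1 i2 : 'I_m) (j1 j2 : 'I_n), i1 = j1 :> nat -> i2 = j2 :> nat ->
    (i1 <= i2)%N -> S i2 j2 <= S i1 j1) ->
  (\rank Y <= r)%N -> sqn (S - pid_mx r *m S) <= sqn (S - Y).
Proof.
move=> diagS Snneg Ssort rkY; have /is_diag_mxP Sdiag := diagS.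
have [T [TT T2 YT trT]] := row_projector Y.
pose c j := \sum_i S i j ^+ 2.
have c_ge0 j : 0 <= c j by apply: sumr_ge0 => i _; exact: sqr_ge0.
have c_mono (i j : 'I_n) : (i <= j)%N -> c j <= c i.
  exact: sorted_diag_col_sqr.
(* For a symmetric idempotent, [T j j] is the squared norm of row [j], which includes the square of
   [T j j] itself. *)
have T01 j : 0 <= T j j <= 1.
  have Tjj : T j j = \sum_k T j k ^+ 2.
    rewrite -{1}T2 mxE; apply: eq_bigr => k _.
    by rewrite -{2}TT mxE.
  have T0 : 0 <= T j j by rewrite Tjj; apply: sumr_ge0 => k _; exact: sqr_ge0.
  have : T j j ^+ 2 <= T j j.
    rewrite [leRHS]Tjj (bigD1 j) //= lerDl.
    by apply: sumr_ge0 => k _; exact: sqr_ge0.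
  by rewrite T0 /=; nra.
have sum_top : \sum_j T j j * c j <= \sum_(j < n | (j < r)%N) c j.
  apply: sum_weighted_le_top => //.
  by rewrite -[leLHS]/(\tr T) trT ler_nat.
have sqnS : sqn S = \sum_j c j by rewrite sqnE.
(* As [S] is diagonal, zeroing its rows from index [r] on also zeroes its columns from [r] on. *)
have -> : sqn (S - pid_mx r *m S) = sqn S - \sum_(j < n | (j < r)%N) c j.
  rewrite sqnS [X in _ = _ - X]big_mkcond -sumrB sqnE; apply: eq_bigr => j _.
  have [lt_jr|le_rj] := ltnP j r; rewrite ?subrr ?subr0 /c.
    apply: big1 => i _; rewrite [(S - _) i j]mxE [(- (_ *m S)) i j]mxE pid_mulmxE.
    have [eq_ij|/eqP neq_ij] := (i : nat) =P j.
      by rewrite eq_ij lt_jr subrr expr0n.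
    by rewrite Sdiag // if_same subrr expr0n.
  apply: eq_bigr => i _; rewrite [(S - _) i j]mxE [(- (_ *m S)) i j]mxE pid_mulmxE.
  case: ltnP => lt_ir; last by rewrite subr0.
  by rewrite Sdiag ?subrr // neq_ltn (leq_trans lt_ir).
have trST (A : 'M_(m, n)) : sqn (A *m T) = \tr (A^T *m A *m T).
  by rewrite /sqn trmx_mul TT mulmxA mxtrace_mulC !mulmxA T2 -mulmxA mxtrace_mulC.
have sqnST : sqn (S *m T) = \sum_j T j j * c j.
  rewrite trST gram_diag // mul_diag_mx; apply: eq_bigr => j _.
  by rewrite !mxE mulrC.
have pyth (A : 'M_(m, n)) : sqn A = sqn (A *m T) + sqn (A - A *m T).
  have -> : sqn (A - A *m T) = sqn A - \tr (A^T *m A *m T) *+ 2 + sqn (A *m T).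
    rewrite /sqn [(A - A *m T)^T]linearB /= mulmxBl !mulmxBr !linearB /=.
    have -> : \tr ((A *m T)^T *m A) = \tr (A^T *m (A *m T)).
      by rewrite -mxtrace_tr trmx_mul trmxK.
    by rewrite mulmxA; ring.
  by rewrite trST; ring.
rewrite (pyth (S - Y)) mulmxBl YT.
have -> : S - Y - (S *m T - Y) = S - S *m T by rewrite opprB addrA subrK.
have := pyth S; have := sqn_ge0 (S *m T - Y).
by rewrite sqnST; lra.
Qed.

(** * Perron-Frobenius for symmetric matrices *)

Lemma rayleigh_max_eigen (R : realFieldType) (n : nat) (A : 'M[R]_n) (lam : R)
    (q : 'cV[R]_n) :
  A^T = A -> (forall x : 'cV_n, \tr (x^T *m A *m x) <= lam * sqn x) ->
  \tr (q^T *m A *m q) = lam * sqn q -> A *m q = lam *: q.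
Proof.
move=> symA le_lam eq_lam; pose B := lam%:M - A.
have BT : B^T = B by rewrite /B linearB /= tr_scalar_mx symA.
have formE (x : 'cV_n) : \tr (x^T *m B *m x) = lam * sqn x - \tr (x^T *m A *m x).
  rewrite /B mulmxBr mulmxBl linearB /= mul_mx_scalar -scalemxAl.
  by rewrite mxtraceZ.
have form_ge0 (x : 'cV_n) : 0 <= \tr (x^T *m B *m x).
  by rewrite formE subr_ge0.
(* The form [B] is nonnegative and vanishes at [q], so the quadratic polynomial
   [t |-> B(q - t y)] is minimal at 0 and its linear coefficient [- 2 * sqn y]
   is zero. *)
pose y := B *m q; pose c := \tr (y^T *m B *m y).
have line t : 0 <= t ^+ 2 * c - 2 * t * sqn y.
  have <- : \tr ((q - t *: y)^T *m B *m (q - t *: y)) =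
            t ^+ 2 * c - 2 * t * sqn y.
    have qBy : \tr (q^T *m B *m y) = sqn y.
      by rewrite /sqn /y trmx_mul BT !mulmxA.
    have yBq : \tr (y^T *m B *m q) = sqn y by rewrite /sqn -mulmxA.
    have qBq : \tr (q^T *m B *m q) = 0 by rewrite formE eq_lam subrr.
    rewrite /c; clearbody B y.
    rewrite [(q - _)^T]linearB /= [(t *: y)^T]linearZ /= !mulmxBl !mulmxBr.
    rewrite -!scalemxAl -!scalemxAr !linearB /= !mxtraceZ qBy yBq qBq.
    by ring.
  exact: form_ge0.
have c_ge0 : 0 <= c by exact: form_ge0.
have y0 : y = 0.
  apply/sqn_eq0/le_anti; rewrite sqn_ge0 andbT.
  have c1 : 0 < c + 1 by rewrite ltr_wpDl.
  (* At this t the polynomial equals - t^2 (c + 2), which forces t = 0; the added 1 keeps the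
     denominator positive when [c] is 0. *)
  have := line (sqn y / (c + 1)).
  have -> : (sqn y / (c + 1)) ^+ 2 * c - 2 * (sqn y / (c + 1)) * sqn y =
            - (sqn y / (c + 1)) ^+ 2 * (c + 2).
    by field; rewrite gt_eqF.
  rewrite mulNr oppr_ge0 pmulr_lle0 ?ltr_wpDl // => sq_le0.
  have /eqP : (sqn y / (c + 1)) ^+ 2 = 0 by apply/le_anti; rewrite sq_le0 sqr_ge0.
  by rewrite sqrf_eq0 mulf_eq0 invr_eq0 (gt_eqF c1) orbF => /eqP ->.
by apply/esym/eqP; rewrite -subr_eq0 -mul_scalar_mx -mulmxBl -/B -/y y0.
Qed.

(** Absolute values cannot lower the form, so [|q|] reaches the maximum too. The two sums then agree
    term by term, and the entries of [q] at the ends of an edge have the same sign; paths propagate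
    this. *)
Lemma perron_same_sign (R : realType) (n : nat) (A : 'M[R]_n) (lam : R)
    (q : 'cV[R]_n) :
  A^T = A -> nonneg_mx A -> irreducible_mx A ->
  (forall x : 'cV_n, \tr (x^T *m A *m x) <= lam * sqn x) ->
  \tr (q^T *m A *m q) = lam * sqn q -> q != 0 ->
  forall i j, 0 < q i 0 * q j 0.
Proof.
move=> symA /mxOverP A_ge0 irrA le_lam eq_lam q_neq0.
have {}A_ge0 i j : 0 <= A i j by exact: A_ge0.
have formE (x : 'cV_n) :
    \tr (x^T *m A *m x) = \sum_i \sum_j x i 0 * A i j * x j 0.
  rewrite trace_mx11 mxE exchange_big; apply: eq_bigr => j _.
  by rewrite mxE mulr_suml; apply: eq_bigr => i _; rewrite mxE.
pose a : 'cV_n := map_mx Num.norm q.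
have sqn_a : sqn a = sqn q.
  rewrite !sqnE; apply: eq_bigr => j _; apply: eq_bigr => i _.
  by rewrite mxE real_normK ?num_real.
have le_term i j : q i 0 * A i j * q j 0 <= a i 0 * A i j * a j 0.
  by rewrite !mxE -[in leRHS](ger0_norm (A_ge0 i j)) -!normrM ler_norm.
have eq_a : \tr (a^T *m A *m a) = lam * sqn a.
  apply/le_anti; rewrite le_lam sqn_a -eq_lam !formE /=.
  by apply: ler_sum => i _; apply: ler_sum.
have Aa : A *m a = lam *: a by exact: rayleigh_max_eigen.
have eq_term i j : q i 0 * A i j * q j 0 = a i 0 * A i j * a j 0.
  have : \sum_i \sum_j (a i 0 * A i j * a j 0 - q i 0 * A i j * q j 0) = 0.
    under eq_bigr do rewrite sumrB.
    by rewrite sumrB -!formE eq_a eq_lam sqn_a subrr.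
  have ge0 k l : 0 <= a k 0 * A k l * a l 0 - q k 0 * A k l * q l 0.
    by rewrite subr_ge0.
  move/psumr_eq0P => /(_ (fun k _ => sumr_ge0 _ (fun l _ => ge0 k l)))/(_ i isT).
  by move/psumr_eq0P => /(_ (fun l _ => ge0 i l))/(_ j isT)/subr0_eq.
have edge i j : A i j != 0 -> q i 0 != 0 -> 0 < q i 0 * q j 0.
  move=> Aij qi; have Aij_gt0 : 0 < A i j by rewrite lt0r Aij A_ge0.
  (* Otherwise row [j] of [A *m a = lam *: a] would be a vanishing sum of nonnegative terms, and the
     edge would force [q i 0 = 0]. *)
  have qj : q j 0 != 0.
    apply: contraTneq qi => qj0; apply/negP => qi.
    have /matrixP/(_ j 0) := Aa; rewrite !mxE qj0 normr0 mulr0 => /psumr_eq0P.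
    have ge0 k : true -> 0 <= A j k * a k 0.
      by move=> _; rewrite mulr_ge0 // mxE.
    move=> /(_ ge0)/(_ i isT)/eqP.
    by rewrite mxE -symA mxE mulf_eq0 normr_eq0 (negPf Aij) (negPf qi).
  have := eq_term i j; rewrite ![_ * A i j]mulrC -!mulrA.
  move/(mulfI Aij) => ->; rewrite !mxE mulr_gt0 // normr_gt0 //.
have walk i p : path [rel x y | A x y != 0] i p -> q i 0 != 0 ->
    0 < q i 0 * q (last i p) 0.
  elim: p i => [|k p IHp] i /=.
    by move=> _ qi; rewrite -expr2 lt0r sqrf_eq0 qi sqr_ge0.
  case/andP => Aik path_p qi; have qiqk := edge _ _ Aik qi.
  have qk : q k 0 != 0 by apply: contraTneq qiqk => ->; rewrite mulr0 ltxx.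
  have := mulr_gt0 qiqk (IHp _ path_p qk).
  rewrite -mulrA [X in _ * X]mulrA -expr2 mulrCA.
  by rewrite pmulr_rgt0 // lt0r sqrf_eq0 qk sqr_ge0.
have q_neq0_all i : q i 0 != 0.
  have /cV0Pn[k qk] := q_neq0.
  have /connectP[p path_p ->] := irrA k i.
  have := walk _ _ path_p qk; apply: contraTneq => ->.
  by rewrite mulr0 ltxx.
move=> i j; have /connectP[p path_p ->] := irrA i j; exact: walk.
Qed.

(** * Nonnegative factors of the truncated SVD *)

Lemma nonneg_factor (R : realFieldType) (r n : nat) (W : 'M[R]_(r, n)) (k : 'I_r) :
  (forall j, 0 < W k j) ->
  exists (E : 'M_r) (V : 'M_(r, n)), V \is a mxOver Num.nneg /\ W = E *m V.
Proof.
move=> Wk; pose c := \sum_i \sum_j `|W i j| / W k j.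
have c_ge0 : 0 <= c.
  by do 2!apply: sumr_ge0 => ? _; rewrite divr_ge0 // ltW.
pose V := \matrix_(i, j) (W i j + c * W k j).
(* Let K have ones in column [k] and zeros elsewhere, so that V = (1 + c K) W. As K^2 = K, the
   inverse of 1 + c K is this matrix. *)
exists (1%:M - (c / (1 + c)) *: \matrix_(i, l) (l == k)%:R), V; split.
  apply/mxOverP => i j; rewrite mxE nnegrE -lerBlDl sub0r.
  rewrite -ler_pdivrMr //.
  apply: le_trans (_ : `|W i j| / W k j <= _).
    apply: ler_wpM2r; first by rewrite invr_ge0 ltW.
    by rewrite -normrN ler_norm.
  rewrite /c (bigD1 i) //= (bigD1 j) //= -addrA lerDl addr_ge0 //.
    by apply: sumr_ge0 => l _; rewrite divr_ge0 // ltW.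
  by do 2!apply: sumr_ge0 => ? _; rewrite divr_ge0 // ltW.
rewrite mulmxBl mul1mx -scalemxAl; apply/matrixP => i j.
have -> : (\matrix_(i < r, l < r) (l == k)%:R) *m V = \matrix_(i, j) V k j.
  apply/matrixP => i' j'; rewrite !mxE (bigD1 k) //= big1 ?addr0.
    by rewrite !mxE eqxx mul1r.
  by move=> l lk; rewrite mxE (negPf lk) mul0r.
rewrite !mxE; field.
by rewrite gt_eqF // ltr_pwDl.
Qed.

(** In the coordinates [Q^T *m x] the form of [M^T *m M] is diagonal with coefficients [c]. The
    largest is [c 0], attained at the first column of [Q], so that column is a Perron vector up to
    sign. *)
Lemma top_right_singular_vector_sign (R : realType) (m n : nat)
    (M : 'M[R]_(m, n.+1)) P S Q :
  nonneg_mx M -> irreducible_mx (M^T *m M) -> is_svd M P S Q ->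
  forall i j, 0 < Q i 0 * Q j 0.
Proof.
move=> M_ge0 irrM [eqM P1 Q1 diagS S_ge0 S_sort].
have QQT : Q *m Q^T = 1%:M by exact: mulmx1C.
pose c j := \sum_i S i j ^+ 2.
have sqnM (x : 'cV_n.+1) :
    \tr (x^T *m (M^T *m M) *m x) = \sum_j (Q^T *m x) j 0 ^+ 2 * c j.
  transitivity (sqn (S *m (Q^T *m x))).
    by rewrite -(sqn_mulmx _ P1) !mulmxA -eqM /sqn trmx_mul !mulmxA.
  move: (Q^T *m x) => y; rewrite /sqn trmx_mul mulmxA -(mulmxA _ S^T) gram_diag //.
  rewrite mul_mx_diag.
  rewrite trace_mx11 mxE; apply: eq_bigr => j _; rewrite ![in LHS]mxE.
  by rewrite mulrAC -expr2.
pose q : 'cV_n.+1 := Q *m delta_mx 0 0.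
have sqn_q : sqn q = 1.
  by rewrite (sqn_mulmx _ Q1) /sqn trmx_delta mul_delta_mx trace_mx11 mxE !eqxx.
have qE i : q i 0 = Q i 0 by rewrite /q -colE mxE.
move=> i j; rewrite -!qE; apply: (@perron_same_sign _ _ (M^T *m M) (c 0)) => //.
- by rewrite trmx_mul trmxK.
- apply/mxOverP => k l; rewrite mxE nnegrE; apply: sumr_ge0 => h _.
  by rewrite mxE mulr_ge0 //; exact: (mxOverP M_ge0).
- move=> x; rewrite sqnM.
  have <- : sqn (Q^T *m x) = sqn x by rewrite sqn_mulmx // trmxK.
  rewrite sqnE big_ord1 mulr_sumr; apply: ler_sum => k _.
  by rewrite mulrC ler_wpM2r ?sqr_ge0 //; exact: sorted_diag_col_sqr.
- rewrite sqnM /q mulmxA Q1 mul1mx -/q sqn_q mulr1 (bigD1 0) //= big1.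
    by rewrite mxE !eqxx expr1n mul1r addr0.
  by move=> k /negPf k0; rewrite mxE k0 expr0n mul0r.
- by apply: contra_eq_neq sqn_q => ->; rewrite /sqn mulmx0 mxtrace0 eq_sym oner_eq0.
Qed.

Theorem corollary5 (R : realType) (m n r : nat) (M : 'M[R]_(m, n))
    (M_ge0 : nonneg_mx M) (MTM_irr : irreducible_mx (M^T *m M)) :
  (exists X : 'M[R]_(m, n), is_truncated_svd r M X) /\
  forall X : 'M[R]_(m, n), is_truncated_svd r M X ->
    [/\ is_best_rank_approx r M X,
        exists (U : 'M[R]_(m, r)) (V : 'M[R]_(r, n)),
          nonneg_mx V /\ X = U *m V
      & forall (U : 'M[R]_(m, r)) (V : 'M[R]_(r, n)),
          nonneg_mx V -> X = U *m V -> is_semi_nmf_solution M U V].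
Proof.
split.
  have [P [S [Q svdM]]] := svd_exists M.
  by exists (P *m (pid_mx r *m S) *m Q^T), P, S, Q.
move=> X [P [S [Q [svdM eqX]]]].
have [eqM P1 Q1 diagS S_ge0 S_sort] := svdM.
(* Truncating the rows of a diagonal [S] truncates its columns too, so a second truncation can be
   inserted and split between the factors. [W] holds the leading right singular vectors, padded with
   zero rows if r > n. *)
pose U0 : 'M_(m, r) := P *m (pid_mx r *m S) *m pid_mx r.
pose W : 'M_(r, n) := pid_mx r *m Q^T.
have XUW : X = U0 *m W.
  suff pidS : pid_mx r *m S *m (pid_mx r : 'M_(n, r)) *m (pid_mx r : 'M_(r, n)) =
      pid_mx r *m S :> 'M_(m, n).
    by rewrite eqX -pidS /U0 /W !mulmxA.
  rewrite -[LHS]mulmxA pid_mx_id //.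
  apply/matrixP => i j; rewrite mulmx_pidE pid_mulmxE.
  case: ifP => // /negbT; rewrite -leqNgt => le_rj; case: ifP => // lt_ir.
  by rewrite (is_diag_mxP diagS) // neq_ltn (leq_trans lt_ir).
have bestX : is_best_rank_approx r M X.
  split=> [|Y rkY]; first by rewrite XUW mulmx_max_rank.
  apply: ler_frobenius.
  have PPT : P *m P^T = 1%:M by exact: mulmx1C.
  have QQT : Q *m Q^T = 1%:M by exact: mulmx1C.
  have -> : M - X = P *m (S - pid_mx r *m S) *m Q^T.
    by rewrite eqM eqX mulmxBr mulmxBl.
  (* Orthogonal changes of basis preserve the norm and reduce the comparison to [S] and a matrix of
     rank at most that of [Y]. *)
  have -> : M - Y = P *m (S - P^T *m Y *m Q) *m Q^T.
    rewrite mulmxBr mulmxBl -eqM !mulmxA PPT mul1mx -mulmxA QQT mulmx1 //.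
  rewrite !sqn_orthogonal //; apply: eckart_young_diag => //.
  apply: leq_trans rkY; apply: leq_trans (mxrankM_maxl _ _) _.
  exact: mxrankM_maxr.
split=> //; last first.
  move=> U V V_ge0 XUV; split=> // U' V' _.
  rewrite -XUV ler_sqr ?nnegrE ?frobeniusE ?sqrtr_ge0 //.
  rewrite -!frobeniusE; apply: bestX.2; exact: mulmx_max_rank.
(* Row 0 of [W] and column 0 of [Q] exist only for positive n and r; otherwise [X] is zero. *)
case: n => [|n'] in M M_ge0 MTM_irr X P S Q svdM eqX eqM P1 Q1 diagS S_ge0 S_sort
  U0 W XUW bestX *.
  by exists 0, 0; split; [apply/mxOverP => i [] | apply/matrixP => i []].
case: r => [|r'] in U0 W XUW eqX bestX *.
  exists 0, 0; split; first by apply/mxOverP => - [].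
  by rewrite eqX pid_mx_0 mul0mx mulmx0 !mul0mx.
have W0 j : W 0 j = Q j 0.
  rewrite mxE (bigD1 0) //= big1 ?addr0 => [|k k0]; first by rewrite !mxE mul1r.
  rewrite mxE; move: k0; rewrite -val_eqE /= eq_sym => /negPf ->.
  by rewrite mul0r.
have sign := top_right_singular_vector_sign M_ge0 MTM_irr svdM.
(* The common sign of column 0 of [Q] may be negative; then [- W] is factored and the sign moves to
   the left factor. *)
have [Q0_gt0|Q0_le0] := ltP 0 (Q 0 0).
  have [|E [V [V_ge0 WEV]]] := @nonneg_factor _ _ _ W 0.
    by move=> j; rewrite W0 -(pmulr_rgt0 _ Q0_gt0).
  by exists (U0 *m E), V; rewrite XUW WEV mulmxA.
have Q0_lt0 : Q 0 0 < 0.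
  rewrite lt_neqAle Q0_le0 andbT.
  by apply: contraTneq (sign 0 0) => ->; rewrite mul0r ltxx.
have [|E [V [V_ge0 WEV]]] := @nonneg_factor _ _ _ (- W) 0.
  by move=> j; rewrite mxE W0 oppr_gt0 -(nmulr_rgt0 _ Q0_lt0).
exists (- (U0 *m E)), V; split=> //.
by rewrite XUW mulNmx -(mulmxA U0) -WEV mulmxN opprK.
Qed.
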